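(* Let $\gamma\in(1,2]$ and $\mathbf U=(D,\mathbf m,E)^\top\in\mathcal G$. The NR-I method $$p_{n+1}=p_n-\frac{\phi(p_n)}{\phi'(p_n)},\qquad p_0=\begin{cases}0,& \text{if } c_2>0,\\ \dfrac{-3c_3+\sqrt{9c_3^2-24c_2}}{12},&\text{otherwise,}\end{cases}$$ has quadratic convergence (to the physical pressure $p(\mathbf U)$).
   Context: Let $d\ge 1$, $\gamma\in(1,2]$, and $\mathcal G=\{(D,\mathbf m,E)^\top: D\in\mathbb R,\ \mathbf m\in\mathbb R^d,\ E\in\mathbb R,\ D>0,\ E-\sqrt{D^2+|\mathbf m|^2}>0\}$. For $\mathbf U\in\mathcal G$ there is a unique triple $(\rho,\mathbf v,p)$ with $\rho>0$, $p>0$, $|\mathbf v|<1$ such that $D=\rho W$, $\mathbf m=DhW\mathbf v$, $E=DhW-p$, where $W=1/\sqrt{1-|\mathbf v|^2}$, $h=1+e+p/\rho$, $e=\frac{p}{(\gamma-1)\rho}$. The physical pressure $p(\mathbf U)$ is the component $p$ of this triple; it is the unique positive solution of $$\Phi(p):=\frac{p}{\gamma-1}-E+\frac{|\mathbf m|^2}{E+p}+D\sqrt{1-\frac{|\mathbf m|^2}{(E+p)^2}}=0 .$$ The quartic polynomial $\phi$ is $$\phi(p)=(\gamma-1)^2\Big[\big(|\mathbf m|^2+(E+p)(\tfrac{p}{\gamma-1}-E)\big)^2-D^2\big((E+p)^2-|\mathbf m|^2\big)\Big]=c_0+c_1p+c_2p^2+c_3p^3+p^4,$$ with $c_0=(|\mathbf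 m|^2-E^2)(|\mathbf m|^2-E^2+D^2)(\gamma-1)^2$, $c_1=2E(2-\gamma)(|\mathbf m|^2-E^2)(\gamma-1)-2ED^2(\gamma-1)^2$, $c_2=E^2(\gamma^2-6\gamma+6)+2|\mathbf m|^2(\gamma-1)-D^2(\gamma-1)^2$, $c_3=2E(2-\gamma)$. Quadratic convergence is meant in the standard sense (order at least $2$): $p_n\to p(\mathbf U)$ and there is a constant $C$ with $|p_{n+1}-p(\mathbf U)|\le C|p_n-p(\mathbf U)|^2$ for all sufficiently large $n$. *)

(* Defs.v *)
From HB Require Import structures.
From mathcomp Require Import all_boot all_order all_algebra.
From mathcomp Require Import ring.
From mathcomp Require Import boolp classical_sets reals topology normedtype.
From mathcomp Require Import sequences.

Set Implicit Arguments.
Unset Strict Implicit.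
Unset Printing Implicit Defensive.

Import Order.TTheory GRing.Theory Num.Theory.
Import numFieldNormedType.Exports.

Local Open Scope classical_set_scope.
Local Open Scope ring_scope.

(* The library norm [`|v|] on matrices is the max norm, not the Euclidean one. *)
Definition enorm (R : realType) (d : nat) (v : 'cV[R]_d) : R :=
  Num.sqrt (\sum_(i < d) v i 0 ^+ 2).

Record conserved (R : realType) (d : nat) := Conserved {
  cD : R;
  cm : 'cV[R]_d;
  cE : R }.

Definition admissible (R : realType) (d : nat) : set (conserved R d) :=
  [set U | 0 < cD U /\ 0 < cE U - Num.sqrt (cD U ^+ 2 + enorm (cm U) ^+ 2)].

Section Primitive.
Variables (R : realType) (d : nat) (gamma : R).

Definition lorentz (v : 'cV[R]_d) : R := 1 / Num.sqrt (1 - enorm v ^+ 2).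

Definition internal_energy (rho p : R) : R := p / ((gamma - 1) * rho).

Definition enthalpy (rho p : R) : R := 1 + internal_energy rho p + p / rho.

Definition is_primitive (U : conserved R d) (rho : R) (v : 'cV[R]_d) (p : R) :=
  let W := lorentz v in
  let h := enthalpy rho p in
  [/\ 0 < rho, 0 < p & enorm v < 1] /\
  [/\ cD U = rho * W,
      cm U = (cD U * h * W) *: v
    & cE U = cD U * h * W - p].

(* [get A] is an element of [A] whenever [A] is nonempty; for admissible [U] the
   set below is a singleton. *)
Definition physical_pressure (U : conserved R d) : R :=
  get [set p | exists rho v, is_primitive U rho v p].

End Primitive.

Section Quartic.
Variables (R : realType) (d : nat) (gamma : R) (U : conserved R d).

Let D := cD U.
Let E := cE U.
Let m2 := enorm (cm U) ^+ 2.

Definition phi : {poly R} :=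
  (gamma - 1) ^+ 2 *:
    ((m2%:P + (E%:P + 'X) * ((gamma - 1)^-1 *: 'X - E%:P)) ^+ 2
     - D ^+ 2 *: ((E%:P + 'X) ^+ 2 - m2%:P)).

Definition c0 : R := (m2 - E ^+ 2) * (m2 - E ^+ 2 + D ^+ 2) * (gamma - 1) ^+ 2.

Definition c1 : R :=
  2 * E * (2 - gamma) * (m2 - E ^+ 2) * (gamma - 1)
  - 2 * E * D ^+ 2 * (gamma - 1) ^+ 2.

Definition c2 : R :=
  E ^+ 2 * (gamma ^+ 2 - 6 * gamma + 6) + 2 * m2 * (gamma - 1)
  - D ^+ 2 * (gamma - 1) ^+ 2.

Definition c3 : R := 2 * E * (2 - gamma).

Lemma phiE : gamma != 1 ->
  phi = c0%:P + c1 *: 'X + c2 *: 'X^2 + c3 *: 'X^3 + 'X^4.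
Proof.
rewrite -subr_eq0 => g1.
have -> : phi = (((gamma - 1) * m2)%:P
     + (E%:P + 'X) * ('X - ((gamma - 1) * E)%:P)) ^+ 2
     - ((gamma - 1) * D)%:P ^+ 2 * ((E%:P + 'X) ^+ 2 - m2%:P).
  have -> : 'X - ((gamma - 1) * E)%:P
      = (gamma - 1)%:P * ((gamma - 1)^-1 *: 'X - E%:P) :> {poly R}.
    by rewrite mulrBr mul_polyC scalerA mulfV// scale1r polyCM.
  rewrite /phi -!mul_polyC !(rmorphM, rmorphXn)/=; ring.
rewrite /c0 /c1 /c2 /c3 -!mul_polyC.
rewrite !(rmorphM, rmorphXn, rmorphD, rmorphN, rmorph1, rmorph_nat)/=.
ring.
Qed.

Definition NR_start : R :=
  if 0 < c2 then 0
  else (- 3 * c3 + Num.sqrt (9 * c3 ^+ 2 - 24 * c2)) / 12.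

Definition NR_step (p : R) : R := p - phi.[p] / phi^`().[p].

Definition NR_iterate (n : nat) : R := iter n NR_step NR_start.

End Quartic.

Definition quadratic_convergence (R : realType) (u : nat -> R) (l : R) :=
  u n @[n --> \oo] --> l /\
  exists C : R, \forall n \near \oo, `|u n.+1 - l| <= C * `|u n - l| ^+ 2.

(* Main.v *)
(** By the mean value theorem, [phi p = phi'(xi) (p - l)] with [xi] between the
root [l] and [p], so a Newton step multiplies the error by
[1 - phi'(xi) / phi'(p)]. If [phi'] is negative and nonincreasing along the
segment from [l] to the start [x0], this factor lies in
[[0, 1 - phi'(l) / phi'(x0)]], which gives convergence; the second-derivative
bound makes it quadratic. The start is either [0] with [phi] convex on
[[0, +oo[], or the largest inflection point of [phi]. In the latter case the
physical pressure may lie on either side of [x0]: [phi] is convex to the right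
of [x0] and concave on [[0, x0]], so [phi'] is monotone in the required sense
both ways, and it remains to see that [phi'(l) < 0]. *)
Require Import Defs.
From mathcomp Require Import all_boot all_order all_algebra.
From mathcomp Require Import boolp classical_sets reals topology normedtype.
From mathcomp Require Import sequences.
From mathcomp Require Import ring lra polyrcf.

Import Order.TTheory GRing.Theory Num.Theory.
Import numFieldNormedType.Exports.

Local Open Scope ring_scope.

(** * Newton's method for a polynomial along a segment ending at a root *)

(** The mean value theorem for [f] composed with an affine map. The parameters [s <= t] are ordered
    whatever the sign of [e], so no case split on the direction is needed. *)
Lemma poly_mvt_segment (R : rcfType) (f : {poly R}) (l e s t : R) : s <= t ->
  exists2 u, s <= u <= t &
    f.[l + t * e] - f.[l + s * e] = f^`().[l + u * e] * ((t - s) * e).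
Proof.
rewrite le_eqVlt => /predU1P[<-|st].
  by exists s; rewrite ?lexx// !subrr mul0r mulr0.
pose g := f \Po (l%:P + e *: 'X).
have gE x : g.[x] = f.[l + x * e] by rewrite horner_comp !hornerE mulrC.
have [u + gst] := poly_mvt g st; rewrite in_itv/= => /andP[/ltW su /ltW ut].
exists u; first by rewrite su ut.
rewrite -!gE gst.
rewrite deriv_comp derivD derivC derivZ derivX add0r hornerM horner_comp.
by rewrite !(hornerD, hornerZ, hornerC, hornerX) (mulrC e u) mulr1; ring.
Qed.

(* Points of the segment from [l] to [x0] are written [l + t * (x0 - l)], which
   treats both positions of [x0] relative to the root at once. *)
Lemma newton_step_segment (R : rcfType) (f : {poly R}) (l x0 t : R) :
    root f l -> f^`().[l] < 0 ->
    (forall s u, 0 <= s -> s <= u -> u <= 1 ->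
      f^`().[l + u * (x0 - l)] <= f^`().[l + s * (x0 - l)]) ->
    0 <= t <= 1 ->
  let x := l + t * (x0 - l) in
  exists s v, [/\ 0 <= s <= 1 - f^`().[l] / f^`().[x0], 0 <= v <= 1,
    x - f.[x] / f^`().[x] = l + (s * t) * (x0 - l) &
    `|x - f.[x] / f^`().[x] - l| <=
      `|f^`()^`().[l + v * (x0 - l)]| / `|f^`().[l]| * `|x - l| ^+ 2].
Proof.
move=> /eqP fl f'l mono /andP[t0 t1] x.
have [r /andP[r0 rt]] := @poly_mvt_segment _ f l (x0 - l) _ _ t0.
rewrite mul0r addr0 fl !subr0 -/x => fx.
have [v /andP[rv vt] f''] := @poly_mvt_segment _ f^`() l (x0 - l) _ _ rt.
rewrite -/x in f''.
have lr : f^`().[l + r * (x0 - l)] <= f^`().[l].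
  by have := mono 0 r; rewrite mul0r addr0; apply => //; exact: le_trans t1.
have rx : f^`().[x] <= f^`().[l + r * (x0 - l)] by exact: mono.
have xx0 : f^`().[x0] <= f^`().[x].
  by have := mono t 1; rewrite mul1r [l + (x0 - l)]addrC subrK; apply.
have f'x : f^`().[x] < 0 by lra.
have f'x0 : f^`().[x0] < 0 by lra.
have f'xn0 : f^`().[x] != 0 by rewrite lt_eqF.
have step : x - f.[x] / f^`().[x] - l =
    (1 - f^`().[l + r * (x0 - l)] / f^`().[x]) * t * (x0 - l).
  by rewrite fx /x; field.
exists (1 - f^`().[l + r * (x0 - l)] / f^`().[x]), v; split.
- apply/andP; split.
    by rewrite subr_ge0 ler_ndivrMr// mul1r.
  rewrite lerD2l lerN2 ler_ndivrMr// mulrAC ler_ndivrMr//.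
  nra.
- by apply/andP; split; lra.
- by rewrite -step; ring.
(* A second mean value step, on [f'], turns the contraction factor into [f''] times
   [(t - r) * (x0 - l)]; since [0 <= r <= t], this length is at most [|x - l|], whence the
   square. *)
have -> : x - f.[x] / f^`().[x] - l =
    f^`()^`().[l + v * (x0 - l)] / f^`().[x] * ((x - l) * ((t - r) * (x0 - l))).
  rewrite step.
  have -> : 1 - f^`().[l + r * (x0 - l)] / f^`().[x] =
      (f^`().[x] - f^`().[l + r * (x0 - l)]) / f^`().[x] by field.
  by rewrite f'' /x; field.
rewrite 2!normrM normrV ?unitfE//.
apply: ler_pM; rewrite ?mulr_ge0 ?invr_ge0//.
- rewrite ler_wpM2l// lef_pV2 ?posrE ?normr_gt0 ?lt_eqF// !ltr0_norm//.
  by rewrite lerN2; lra.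
- rewrite normrM expr2 ler_wpM2l//.
  have -> : x - l = t * (x0 - l) by rewrite /x; ring.
  by rewrite !normrM ler_wpM2r// !ger0_norm//; lra.
Qed.

Lemma newton_quadratic_convergence (R : realType) (f : {poly R}) (l x0 : R) :
    root f l -> f^`().[l] < 0 ->
    (forall s t, 0 <= s -> s <= t -> t <= 1 ->
      f^`().[l + t * (x0 - l)] <= f^`().[l + s * (x0 - l)]) ->
  let u n := iter n (fun x => x - f.[x] / f^`().[x]) x0 in
  (forall n, f^`().[u n] != 0) /\ quadratic_convergence u l.
Proof.
move=> fl f'l mono u.
set k := 1 - f^`().[l] / f^`().[x0].
have f'x0l : f^`().[x0] <= f^`().[l].
  have := mono 0 1 (lexx _) ler01 (lexx _).
  by rewrite mul0r mul1r addr0 [l + (x0 - l)]addrC subrK.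
have f'x0 : f^`().[x0] < 0 by exact: le_lt_trans f'l.
have k0 : 0 <= k by rewrite /k subr_ge0 ler_ndivrMr// mul1r.
have k1 : k < 1 by rewrite /k ltrBlDr ltrDl nmulr_lgt0 ?invr_lt0.
(* Each step multiplies the parameter [t] by a factor in [[0, k]], so the iterates stay on the
   segment, where [mono] applies, and approach [l] geometrically. *)
have seg n : exists2 t, 0 <= t <= k ^+ n & u n = l + t * (x0 - l).
  elim: n => [|n [t /andP[t0 tk] un]].
    by exists 1; rewrite ?lexx ?ler01//= mul1r addrC subrK.
  have t1 : 0 <= t <= 1.
    by rewrite t0 (le_trans tk)// exprn_ile1// ltW.
  have [s [_ [/andP[s0 sk] _ + _]]] := @newton_step_segment _ f l x0 t fl f'l mono t1.
  rewrite -un => step; exists (s * t); last exact: step.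
  by rewrite mulr_ge0//= exprS ler_pM.
have unit01 n t : 0 <= t <= k ^+ n -> 0 <= t <= 1.
  by move=> /andP[-> tk]/=; rewrite (le_trans tk)// exprn_ile1// ltW.
split=> [n|].
  have [t /unit01 /andP[t0 t1] ->] := seg n.
  have := mono 0 t (lexx _) t0 t1; rewrite mul0r addr0 => h.
  by rewrite lt_eqF//; exact: le_lt_trans f'l.
split.
  have lim0 : ((fun n => k ^+ n * `|x0 - l|) @ \oo --> (0 : R))%classic.
    rewrite -[X in (_ --> X)%classic](mul0r `|x0 - l|).
    by apply: cvgMl; apply: cvg_expr; rewrite ger0_norm.
  apply/cvgrPdist_le => e e0.
  move/cvgrPdist_le : lim0 => /(_ _ e0); apply: filterS => n.
  rewrite sub0r normrN; apply: le_trans.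
  have [t /andP[t0 tk] ->] := seg n.
  rewrite opprD addrA subrr sub0r normrN !normrM normr_id ler_wpM2r//.
  by rewrite ger0_norm// (le_trans tk)// ler_norm.
(* This disk contains the whole segment, so [K] bounds [f''] uniformly in [n]. *)
have [K Kb] := poly_disk_bound f^`()^`() (`|l| + `|x0 - l|).
exists (K / `|f^`().[l]|); near=> n.
have [t /unit01 t01 un] := seg n.
have [s [v [_ /andP[v0 v1] _ +]]] := @newton_step_segment _ f l x0 t fl f'l mono t01.
rewrite -un => /le_trans; apply.
rewrite ler_wpM2r ?exprn_ge0// ler_wpM2r ?invr_ge0//.
apply: Kb; apply: (le_trans (ler_normD _ _)); rewrite lerD2l normrM.
by rewrite ger0_norm// ler_piMl.
Unshelve. all: by end_near.
Qed.

(** * Primitive variables and the pressure equation *)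

Lemma enorm_scale_sqr (R : realType) (d : nat) (c : R) (v : 'cV[R]_d) :
  enorm (c *: v) ^+ 2 = c ^+ 2 * enorm v ^+ 2.
Proof.
rewrite /enorm !sqr_sqrtr ?sumr_ge0// => [|i _|i _]; rewrite ?sqr_ge0//.
by rewrite mulr_sumr; apply: eq_bigr => i _; rewrite mxE exprMn.
Qed.

(* Here [s] stands for [x sqrt(1 - |m|^2 / x^2)] with [x = E + p]; the second
   equation is then [(gamma - 1) x Phi(p) = 0], and requiring it with [s > 0]
   separates the physical root of the quartic from the spurious one. *)
Definition pressure_eq {R : realType} {d : nat} (gamma : R) (U : conserved R d)
    (p s : R) : Prop :=
  s ^+ 2 = (cE U + p) ^+ 2 - enorm (cm U) ^+ 2 /\
  (cE U + p) ^+ 2 - gamma * cE U * (cE U + p) + (gamma - 1) * enorm (cm U) ^+ 2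
    = - ((gamma - 1) * cD U * s).

Lemma primitive_pressure_eq (R : realType) (d : nat) (gamma : R)
    (U : conserved R d) (rho : R) (v : 'cV[R]_d) (p : R) :
  1 < gamma -> is_primitive gamma U rho v p ->
  0 < p /\ exists2 s, 0 < s & pressure_eq gamma U p s.
Proof.
move=> g1 [[rho0 p0 v1] [DE mE EE]]; split=> //.
have w1 : 0 < 1 - enorm v ^+ 2.
  by rewrite subr_gt0 expr_lt1 ?sqrtr_ge0.
have W0 : 0 < lorentz v by rewrite divr_gt0 ?sqrtr_gt0.
have W2 : lorentz v ^+ 2 * (1 - enorm v ^+ 2) = 1.
  by rewrite /lorentz expr_div_n sqr_sqrtr ?ltW// expr1n mul1r mulVf ?gt_eqF.
have rho_n0 : rho != 0 by rewrite gt_eqF.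
have a0 : 0 < gamma - 1 by rewrite subr_gt0.
have an0 : gamma - 1 != 0 by rewrite gt_eqF.
have h0 : 0 < enthalpy gamma rho p.
  by rewrite !addr_gt0 ?divr_gt0 ?mulr_gt0.
have hE : (gamma - 1) * rho * (enthalpy gamma rho p - 1) = gamma * p.
  by rewrite /enthalpy /internal_energy; field; rewrite an0 rho_n0.
move: (enthalpy _ _ _) (lorentz v) h0 hE W0 W2 DE mE EE => h W h0 hE W0 W2 DE mE EE.
have D0 : 0 < cD U by rewrite DE mulr_gt0.
(* As [x = D h W] and [|m| = x |v|], the root [sqrt(x^2 - |m|^2) = x / W] is [D h]. *)
exists (cD U * h); first by rewrite mulr_gt0.
rewrite /pressure_eq; have -> : cE U + p = cD U * h * W by rewrite EE subrK.
have M : enorm (cm U) ^+ 2 = (cD U * h * W) ^+ 2 - (cD U * h) ^+ 2.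
  by rewrite mE enorm_scale_sqr -[in RHS](mulr1 ((cD U * h) ^+ 2)) -W2; ring.
rewrite M; split; first by ring.
apply/eqP; rewrite -subr_eq0; apply/eqP.
rewrite EE.
transitivity (cD U * h * W * (gamma * p) - (gamma - 1) * cD U * cD U * h * (h - 1)).
  by ring.
by rewrite -hE DE; ring.
Qed.

(** The primitive state is recovered from [x = E + p] and [s] by [v = m / x], [W = x / s],
    [rho = D s / x] and [h = s / D]. *)
Lemma pressure_eq_primitive (R : realType) (d : nat) (gamma : R)
    (U : conserved R d) (p s : R) :
  1 < gamma -> 0 < cD U -> 0 < cE U -> 0 < p -> 0 < s ->
  pressure_eq gamma U p s -> exists rho v, is_primitive gamma U rho v p.
Proof.
move=> g1 D0 E0 p0 s0 [s2 root_eq].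
have x0 : 0 < cE U + p by rewrite addr_gt0.
set x := cE U + p in x0 s2 root_eq.
set M := enorm (cm U) ^+ 2 in s2 root_eq.
have xn0 : x != 0 by rewrite gt_eqF.
have sn0 : s != 0 by rewrite gt_eqF.
have Dn0 : cD U != 0 by rewrite gt_eqF.
have an0 : gamma - 1 != 0 by rewrite gt_eqF// subr_gt0.
have vE : enorm (x^-1 *: cm U) ^+ 2 = x^-1 ^+ 2 * M by rewrite enorm_scale_sqr.
have lorE : lorentz (x^-1 *: cm U) = x / s.
  have -> : lorentz (x^-1 *: cm U) = 1 / Num.sqrt ((s / x) ^+ 2).
    by rewrite /lorentz vE expr_div_n s2; congr (1 / Num.sqrt _); field.
  by rewrite sqrtr_sqr ger0_norm ?divr_ge0 1?ltW// div1r invf_div.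
have hE : enthalpy gamma (cD U * s / x) p = s / cD U.
  rewrite /enthalpy /internal_energy.
  have -> : 1 + p / ((gamma - 1) * (cD U * s / x)) + p / (cD U * s / x) =
      1 + gamma * p * x / ((gamma - 1) * cD U * s).
    by field; rewrite an0 Dn0 sn0 xn0.
  have -> : gamma * p * x = (gamma - 1) * s ^+ 2 - (gamma - 1) * cD U * s.
    rewrite -[X in _ = _ - X]opprK -root_eq s2 /x; ring.
  by field; rewrite an0 Dn0 sn0.
exists (cD U * s / x), (x^-1 *: cm U); split; split=> //.
- by rewrite !mulr_gt0 ?invr_gt0.
- rewrite -(@expr_lt1 _ 2) ?sqrtr_ge0// vE.
  rewrite exprVn mulrC ltr_pdivrMr ?exprn_gt0// mul1r.
  by rewrite -subr_gt0 -s2 exprn_gt0.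
- by rewrite lorE; field; rewrite sn0 xn0.
- by rewrite lorE hE scalerA -[LHS]scale1r; congr (_ *: _); field; rewrite Dn0 sn0 xn0.
- rewrite lorE hE; transitivity (x - p); first by rewrite /x addrK.
  by field; rewrite Dn0 sn0.
Qed.

(** * The quartic, its slope at the pressure, and existence of the pressure *)

Lemma admissible_bounds (R : realType) (d : nat) (U : conserved R d) :
  admissible U -> [/\ 0 < cD U, 0 < cE U &
    cD U ^+ 2 + enorm (cm U) ^+ 2 < cE U ^+ 2].
Proof.
move=> [D0]; rewrite subr_gt0 => sE.
have E0 : 0 < cE U by apply: le_lt_trans sE; rewrite sqrtr_ge0.
split=> //; rewrite -[ltLHS]sqr_sqrtr ?addr_ge0 ?sqr_ge0//.
by rewrite ltr_pXn2r// ?nnegrE ?sqrtr_ge0 ?ltW.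
Qed.

Lemma phi_hornerE (R : realType) (d : nat) (gamma : R) (U : conserved R d) (p : R) :
  gamma != 1 ->
  (phi gamma U).[p] =
    ((cE U + p) ^+ 2 - gamma * cE U * (cE U + p)
      + (gamma - 1) * enorm (cm U) ^+ 2) ^+ 2
    - (gamma - 1) ^+ 2 * cD U ^+ 2 * ((cE U + p) ^+ 2 - enorm (cm U) ^+ 2).
Proof.
move=> g1; rewrite phiE//.
rewrite !(hornerD, hornerZ, hornerC, hornerX, hornerXn) /c0 /c1 /c2 /c3; ring.
Qed.

Lemma deriv_phi_hornerE (R : realType) (d : nat) (gamma : R) (U : conserved R d)
    (p : R) : gamma != 1 ->
  (phi gamma U)^`().[p] =
    c1 gamma U + 2 * c2 gamma U * p + 3 * c3 gamma U * p ^+ 2 + 4 * p ^+ 3.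
Proof.
move=> g1; rewrite phiE//.
rewrite !(derivD, derivZ, derivC, derivX, derivXn).
rewrite !(hornerD, hornerZ, hornerC, hornerX, hornerMn, hornerXn).
ring.
Qed.

Lemma pressure_eq_root (R : realType) (d : nat) (gamma : R) (U : conserved R d)
    (p s : R) :
  1 < gamma -> pressure_eq gamma U p s -> root (phi gamma U) p.
Proof.
move=> g1 [s2 root_eq]; apply/eqP.
by rewrite phi_hornerE ?gt_eqF// root_eq -s2; ring.
Qed.

(* Put [q(x) = x^2 - gamma E x + (gamma - 1) |m|^2] with [x = E + p], so that
   [phi = q^2 - ((gamma - 1) D s)^2] vanishes through its factor
   [q + (gamma - 1) D s], whose derivative times [x s] is
   [s (x^2 - (gamma - 1) |m|^2) + (gamma - 1) D |m|^2 > 0]. *)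
Lemma pressure_eq_deriv_lt0 (R : realType) (d : nat) (gamma : R)
    (U : conserved R d) (p s : R) :
  1 < gamma <= 2 -> 0 < cD U -> 0 < cE U -> 0 < p -> 0 < s ->
  pressure_eq gamma U p s -> (phi gamma U)^`().[p] < 0.
Proof.
move=> /andP[g1 g2] D0 E0 p0 s0 [s2 root_eq].
have x0 : 0 < cE U + p by rewrite addr_gt0.
have dE : (cE U + p) * (phi gamma U)^`().[p] = - (2 * (gamma - 1) * cD U *
    (s * ((cE U + p) ^+ 2 - (gamma - 1) * enorm (cm U) ^+ 2)
     + (gamma - 1) * cD U * enorm (cm U) ^+ 2)).
  rewrite deriv_phi_hornerE ?gt_eqF//.
  move: s2 root_eq; rewrite /c1 /c2 /c3; set M := enorm _ ^+ 2.
  set E := cE U; set D := cD U => s2 root_eq.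
  have M2 : M = (E + p) ^+ 2 - s ^+ 2 by rewrite s2 subKr.
  set q := (X in X = _) in root_eq.
  (* This uses [x q'(x) = q(x) + x^2 - (gamma - 1) M], where [x = E + p]. *)
  transitivity (2 * q * (q + (E + p) ^+ 2 - (gamma - 1) * M)
     - 2 * (gamma - 1) ^+ 2 * D ^+ 2 * (E + p) ^+ 2); first by rewrite /q; ring.
  by rewrite root_eq M2; ring.
rewrite -(pmulr_rlt0 _ x0) dE oppr_lt0.
have M0 : 0 <= enorm (cm U) ^+ 2 by rewrite sqr_ge0.
have a0 : 0 < gamma - 1 by rewrite subr_gt0.
have Mx : enorm (cm U) ^+ 2 < (cE U + p) ^+ 2 by rewrite -subr_gt0 -s2 exprn_gt0.
apply: mulr_gt0; first by rewrite !mulr_gt0.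
apply: ltr_wpDr; first exact: mulr_ge0 (mulr_ge0 (ltW a0) (ltW D0)) M0.
rewrite mulr_gt0// subr_gt0; apply: le_lt_trans Mx.
by rewrite ler_piMl//; lra.
Qed.

Lemma pressure_eq_exists (R : realType) (d : nat) (gamma : R) (U : conserved R d) :
  1 < gamma -> admissible U ->
  exists p s, [/\ 0 < p, 0 < s & pressure_eq gamma U p s].
(* [phi] is positive at [0] and negative at [xq - E], where [xq] is the larger
   root of [q]; the root of [phi] in between has [q < 0]. *)
Proof.
move=> g1 /admissible_bounds[D0 E0 DME].
have M0 : 0 <= enorm (cm U) ^+ 2 by rewrite sqr_ge0.
have a0 : 0 < gamma - 1 by rewrite subr_gt0.
pose M := enorm (cm U) ^+ 2.
pose q x := x ^+ 2 - gamma * cE U * x + (gamma - 1) * M.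
pose disc := (gamma * cE U) ^+ 2 - 4 * (gamma - 1) * M.
pose xq := (gamma * cE U + Num.sqrt disc) / 2.
have D2 : 0 < cD U ^+ 2 by rewrite exprn_gt0.
have ME : M < cE U ^+ 2 by rewrite /M; lra.
have disc0 : 0 <= disc.
  rewrite /disc; have : 4 * (gamma - 1) * M <= 4 * (gamma - 1) * cE U ^+ 2.
    by rewrite ler_wpM2l ?mulr_ge0// ltW.
  have : 0 <= ((gamma - 2) * cE U) ^+ 2 by rewrite sqr_ge0.
  by nra.
have qE x : q x = (x - xq) * (x - (gamma * cE U - xq)).
  transitivity (x ^+ 2 - gamma * cE U * x
     + ((gamma * cE U) ^+ 2 - Num.sqrt disc ^+ 2) / 4).
    by rewrite sqr_sqrtr// /q /disc; field.
  by rewrite /xq; field.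
have qEneg : q (cE U) < 0.
  have -> : q (cE U) = (gamma - 1) * (M - cE U ^+ 2) by rewrite /q; ring.
  by rewrite pmulr_rlt0// subr_lt0.
have sq0 : 0 <= Num.sqrt disc by rewrite sqrtr_ge0.
have gE : gamma * cE U - xq <= xq by rewrite /xq; lra.
have /andP[Exq1 Exq2] : gamma * cE U - xq < cE U < xq by move: qEneg; rewrite qE; nra.
have phiq p : (phi gamma U).[p] = q (cE U + p) ^+ 2
    - (gamma - 1) ^+ 2 * cD U ^+ 2 * ((cE U + p) ^+ 2 - M).
  by rewrite phi_hornerE ?gt_eqF.
have aD0 : 0 < (gamma - 1) ^+ 2 * cD U ^+ 2 by rewrite mulr_gt0// exprn_gt0.
(* This value is [c0], whose factors [M - E^2] and [M - E^2 + D^2] are both negative by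
   admissibility. *)
have phi0 : 0 < (phi gamma U).[0].
  rewrite phiq addr0.
  have -> : q (cE U) ^+ 2 - (gamma - 1) ^+ 2 * cD U ^+ 2 * (cE U ^+ 2 - M) =
     (gamma - 1) ^+ 2 * ((cE U ^+ 2 - M) * (cE U ^+ 2 - M - cD U ^+ 2)).
    by rewrite /q; ring.
  by rewrite !mulr_gt0// ?exprn_gt0// /M; lra.
have phixq : (phi gamma U).[xq - cE U] < 0.
  rewrite phiq [cE U + _]addrC subrK qE subrr mul0r expr0n/= sub0r oppr_lt0 mulr_gt0//.
  rewrite subr_gt0 (lt_trans ME)// ltr_pXn2r ?nnegrE//; lra.
have [p /andP[p0 pxq] rp] : exists2 p, 0 <= p <= xq - cE U & root (phi gamma U) p.
  have [||p pI] := @poly_ivt R (- phi gamma U) 0 (xq - cE U).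
  - lra.
  - by rewrite !hornerN; apply/andP; split; lra.
  by rewrite rootN; exists p.
have pn0 : p != 0.
  by apply: contraTneq phi0 => p_0; move/eqP : rp; rewrite p_0 => ->; rewrite ltxx.
have {}p0 : 0 < p by rewrite lt_def pn0.
have pnxq : p != xq - cE U.
  by apply: contraTneq phixq => p_xq; move/eqP : rp; rewrite p_xq => ->; rewrite ltxx.
have {}pxq : p < xq - cE U by rewrite lt_neqAle pnxq.
have s20 : 0 < (cE U + p) ^+ 2 - M by nra.
exists p, (Num.sqrt ((cE U + p) ^+ 2 - M)); rewrite sqrtr_gt0; split=> //.
split; first by rewrite sqr_sqrtr// ltW.
(* The point [E + p] lies between the roots of [q], so [q] is nonpositive there; after negation both
   sides are nonnegative and it suffices to compare squares. *)
apply/oppr_inj; rewrite opprK.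
apply/eqP; rewrite -(@eqrXn2 _ 2)// ?oppr_ge0.
- rewrite sqrrN exprMn (sqr_sqrtr (ltW s20)) exprMn.
  by move/eqP : rp; rewrite phiq => /eqP; rewrite subr_eq0.
- by rewrite -/M -/(q _) qE; nra.
- by rewrite !mulr_ge0 ?sqrtr_ge0// ltW.
Qed.

Lemma physical_pressureP (R : realType) (d : nat) (gamma : R) (U : conserved R d) :
  1 < gamma -> admissible U ->
  0 < physical_pressure gamma U /\
  exists2 s, 0 < s & pressure_eq gamma U (physical_pressure gamma U) s.
Proof.
move=> g1 /[dup] hU /admissible_bounds[D0 E0 _].
have [rho [v]] : exists rho v, is_primitive gamma U rho v (physical_pressure gamma U).
  rewrite /physical_pressure.
  apply: (@getPex _ [set p | exists rho v, is_primitive gamma U rho v p]%classic).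
  have [p [s [p0 s0 ps]]] := @pressure_eq_exists _ _ _ _ g1 hU.
  by exists p; exact: pressure_eq_primitive ps.
exact: primitive_pressure_eq.
Qed.

(** * Monotonicity of the derivative between the root and the start *)

Lemma NR_start_deriv_mono (R : realType) (d : nat) (gamma l : R)
    (U : conserved R d) (s t : R) :
  1 < gamma <= 2 -> 0 <= cE U -> 0 <= l ->
  0 <= s -> s <= t -> t <= 1 ->
  (phi gamma U)^`().[l + t * (NR_start gamma U - l)] <=
    (phi gamma U)^`().[l + s * (NR_start gamma U - l)].
Proof.
move=> /andP[g1 g2] E0 l0 s0 st t1; set x0 := NR_start gamma U.
have c3_ge0 : 0 <= c3 gamma U by rewrite /c3 !mulr_ge0//; lra.
set x := l + t * (x0 - l); set y := l + s * (x0 - l).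
set b := c2 gamma U; set c := c3 gamma U in c3_ge0 *.
rewrite -subr_le0 !deriv_phi_hornerE ?gt_eqF// -/b -/c.
(* The last factor is the divided difference of [phi'] at [x] and [y], so only its sign against that
   of [x0 - l] matters. *)
have -> : c1 gamma U + 2 * b * x + 3 * c * x ^+ 2 + 4 * x ^+ 3
    - (c1 gamma U + 2 * b * y + 3 * c * y ^+ 2 + 4 * y ^+ 3) =
    (t - s) * ((x0 - l) * (2 * b + 3 * c * (x + y)
      + 4 * (x ^+ 2 + x * y + y ^+ 2))) by rewrite /x /y; ring.
rewrite mulr_ge0_le0 ?subr_ge0//.
have hull z : 0 <= z -> z <= 1 ->
    (x0 <= l -> x0 <= l + z * (x0 - l) <= l) /\
    (l <= x0 -> l <= l + z * (x0 - l) <= x0).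
  by move=> z0 z1; split=> ?; apply/andP; split; nra.
have [xd xu] := hull _ (le_trans s0 st) t1.
have [yd yu] := hull _ s0 (le_trans st t1).
rewrite -/x -/y in xd xu yd yu.
move: xd xu yd yu; rewrite /x0 /NR_start -/b -/c.
case: ltP => [b0|b0]; rewrite -?/x0.
  move=> /(_ l0)/andP[x_ge0 _] _ /(_ l0)/andP[y_ge0 _] _.
  rewrite sub0r mulNr oppr_le0 mulr_ge0//.
  have := mulr_ge0 c3_ge0 x_ge0; have := mulr_ge0 c3_ge0 y_ge0.
  have := mulr_ge0 x_ge0 y_ge0; have := sqr_ge0 x; have := sqr_ge0 y; lra.
set r := (_ / 12).
have disc0 : 0 <= 9 * c ^+ 2 - 24 * b.
  by have := sqr_ge0 c; lra.
have r_ge0 : 0 <= r.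
  have c3_3 : 3 * c = Num.sqrt ((3 * c) ^+ 2) by rewrite sqrtr_sqr ger0_norm; lra.
  have : Num.sqrt ((3 * c) ^+ 2) <= Num.sqrt (9 * c ^+ 2 - 24 * b).
    by rewrite ler_wsqrtr// exprMn; lra.
  by rewrite -c3_3 => ?; rewrite divr_ge0//; lra.
(* [r] is the inflection point of [phi]. *)
have rE : 12 * r ^+ 2 + 6 * c * r + 2 * b = 0.
  transitivity ((Num.sqrt (9 * c ^+ 2 - 24 * b) ^+ 2 - 9 * c ^+ 2) / 12 + 2 * b).
    by rewrite /r; field.
  by rewrite sqr_sqrtr//; field.
(* The divided difference increases in [x, y >= 0] and equals [phi''(r) = 0] at [x = y = r]: it is
   nonpositive when both points lie left of [r] and nonnegative when both lie right. *)
move=> xd xu yd yu; have [lr|rl] := leP l r.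
  have /andP[lx xr] := xu lr; have /andP[ly yr] := yu lr.
  rewrite mulr_ge0_le0 ?subr_ge0// -rE; nra.
have /andP[rx xl] := xd (ltW rl); have /andP[ry yl] := yd (ltW rl).
rewrite mulr_le0_ge0 ?subr_le0 ?(ltW rl)// -rE; nra.
Qed.

Theorem theorem2p6 (R : realType) (d : nat) (gamma : R) (U : conserved R d)
    (hd : (1 <= d)%N) (hgamma : 1 < gamma <= 2) (hU : admissible U) :
  (forall n : nat, ((phi gamma U)^`()).[NR_iterate gamma U n] != 0) /\
  quadratic_convergence (NR_iterate gamma U) (physical_pressure gamma U).
Proof.
have g1 : 1 < gamma by case/andP: hgamma.
have [D0 E0 _] := @admissible_bounds _ _ _ hU.
have [p0 [s s0 ps]] := @physical_pressureP _ _ _ _ g1 hU.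
apply: (@newton_quadratic_convergence _ (phi gamma U)).
- exact: pressure_eq_root ps.
- exact: pressure_eq_deriv_lt0 ps.
- by move=> r t r0 rt t1; apply: NR_start_deriv_mono => //; exact: ltW.
Qed.
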